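(* Let $k$ be an algebraically closed field of characteristic zero, let $n\ge 2$ and $m\ge 2$ be integers, let $P(X,Y)=Y^{m}+f_{m-2}(X)Y^{m-2}+\cdots+f_{0}(X)$ with $f_i\in k[X]$, and let $$B_{n,P}=k[X,Y,Z]/\langle X^{n}Z-P(X,Y)\rangle ,$$ with $x,y,z$ the images of $X,Y,Z$. Then every $k$-algebra automorphism $\alpha$ of $B_{n,P}$ has the form $$\alpha(x,y,z)=\left(\lambda x,\ \mu y+x^{n}a(x),\ \frac{\mu^{m}}{\lambda^{n}}z+\frac{P(\lambda x,\ \mu y+x^{n}a(x))-\mu^{m}P(x,y)}{\lambda^{n}x^{n}}\right),$$ where $a(x)\in k[x]$ and $\lambda,\mu\in k^{*}$ satisfy $f_{m-i}(\lambda x)\equiv\mu^{i}f_{m-i}(x)\pmod{x^{n}}$ for all $i\in\{2,\ldots,m\}$.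
   Context: The notation $\alpha(x,y,z)=(a_1,a_2,a_3)$ means $\alpha(x)=a_1$, $\alpha(y)=a_2$, $\alpha(z)=a_3$. Congruences are in the polynomial ring $k[x]$. *)

(* Defs.v *)
From HB Require Import structures.
From mathcomp Require Import all_boot all_algebra.
From mathcomp Require Import boolp.
From mathcomp Require Import mpoly.

Set Implicit Arguments.
Unset Strict Implicit.
Unset Printing Implicit Defensive.

Import GRing.Theory.
Local Open Scope ring_scope.
Local Open Scope quotient_scope.

(* [eval2 u v Q] is Q(u, v), for Q in k[X, Y] and u, v in a k-algebra. *)
Definition eval2 (k : closedFieldType) (A : algType k) (u v : A)
    (Q : {mpoly k[2]}) : A :=
  mmap (in_alg A) (fun i : 'I_2 => if i == ord0 then u else v) Q.

(* In k[X, Y], X is 'X_0 and Y is 'X_1; in k[X, Y, Z], Z is moreover 'X_2. *)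
Notation X2 := ('X_(@inord 1 0)).
Notation Y2 := ('X_(@inord 1 1)).
Notation X3 := ('X_(@inord 2 0)).
Notation Y3 := ('X_(@inord 2 1)).
Notation Z3 := ('X_(@inord 2 2)).

Section Danielewski.
Variables (k : closedFieldType) (n m : nat) (f : nat -> {poly k}).

(* Only f 0, ..., f (m - 2) matter (for m >= 2, the bound m.-1 on j means
   j <= m - 2). *)
Definition Ppoly : {mpoly k[2]} :=
  Y2 ^+ m + \sum_(j < m.-1) horner_alg X2 (f j) * Y2 ^+ j.

Definition Brel : {mpoly k[3]} := X3 ^+ n * Z3 - eval2 X3 Y3 Ppoly.

Definition Bideal : {pred {mpoly k[3]}} :=
  fun p => `[< exists q, p = q * Brel >].

(* The ideal is proper because Brel vanishes at (1, 0, P(1, 0)). *)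
Lemma Bideal_closed : idealr_closed Bideal.
Proof.
split.
- by apply/asboolP; exists 0; rewrite mul0r.
- apply/negP => /asboolP [q Eq].
  pose g (i : 'I_2) : k := if i == ord0 then 1 else 0.
  pose h := tnth [tuple 1; 0; meval g Ppoly].
  have hE j : (j < 3)%N -> meval h 'X_(inord j) = nth 0 [:: 1; 0; meval g Ppoly] j.
    by move=> j3; rewrite mevalXU /h (tnth_nth 0) inordK.
  have hBrel : meval h Brel = 0.
    rewrite /Brel rmorphB rmorphM rmorphXn /= !hE //= expr1n mul1r.
    apply/eqP; rewrite subr_eq0; apply/eqP.
    rewrite /eval2 /mmap rmorph_sum /= mevalE; apply: eq_bigr => M _.
    rewrite rmorphM /= mevalZ rmorph1 mulr1; congr (_ * _).
    rewrite /mmap1 rmorph_prod; apply: eq_bigr => i _ /=.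
    by rewrite rmorphXn /= /g; case: ifP => _; rewrite hE.
  have /eqP := congr1 (meval h) Eq.
  by rewrite rmorph1 rmorphM /= hBrel mulr0 oner_eq0.
- move=> a u v /asboolP [q1 ->] /asboolP [q2 ->]; apply/asboolP.
  by exists (a * q1 + q2); rewrite mulrDl mulrA.
Qed.

HB.instance Definition _ := isIdealr.Build {mpoly k[3]} Bideal Bideal_closed.

Definition Balg := {ideal_quot Bideal}.

HB.instance Definition _ := GRing.ComNzRing.on Balg.

Definition Bpi (p : {mpoly k[3]}) : Balg := \pi_({ideal_quot Bideal}) p.

Definition Bscale (c : k) (b : Balg) : Balg := Bpi c%:MP * b.

Lemma BpiD p q : Bpi (p + q) = Bpi p + Bpi q. Proof. exact: rmorphD. Qed.
Lemma BpiM p q : Bpi (p * q) = Bpi p * Bpi q. Proof. exact: rmorphM. Qed.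

Fact BscaleA c d b : Bscale c (Bscale d b) = Bscale (c * d) b.
Proof. by rewrite /Bscale mulrA -BpiM -mpolyCM. Qed.
Fact Bscale1 : left_id 1 Bscale.
Proof. by move=> b; rewrite /Bscale mpolyC1 /Bpi rmorph1 mul1r. Qed.
Fact BscaleDr : right_distributive Bscale +%R.
Proof. by move=> c b b'; rewrite /Bscale mulrDr. Qed.
Fact BscaleDl b : {morph Bscale^~ b : c d / c + d}.
Proof. by move=> c d; rewrite /Bscale mpolyCD BpiD mulrDl. Qed.

HB.instance Definition _ :=
  GRing.Zmodule_isLmodule.Build k Balg BscaleA Bscale1 BscaleDr BscaleDl.

Fact BscaleAl c (b b' : Balg) : c *: (b * b') = c *: b * b'.
Proof. exact: mulrA. Qed.

HB.instance Definition _ := GRing.Lmodule_isLalgebra.Build k Balg BscaleAl.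

Fact BscaleAr c (b b' : Balg) : c *: (b * b') = b * (c *: b').
Proof. exact: mulrCA. Qed.

HB.instance Definition _ := GRing.Lalgebra_isAlgebra.Build k Balg BscaleAr.

Definition Bx : Balg := Bpi X3.
Definition By : Balg := Bpi Y3.
Definition Bz : Balg := Bpi Z3.

Lemma B_relation : Bx ^+ n * Bz = eval2 Bx By Ppoly.
Proof.
have -> : eval2 Bx By Ppoly = Bpi (eval2 X3 Y3 Ppoly).
  rewrite /eval2 /mmap /Bpi rmorph_sum /=; apply: eq_bigr => M _.
  rewrite rmorphM /=; congr (_ * _).
    by rewrite -[LHS]/(Bpi _%:MP * 1) mulr1 -mul_mpolyC mulr1.
  rewrite /mmap1 rmorph_prod; apply: eq_bigr => i _ /=.
  by rewrite rmorphXn /=; case: ifP.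
rewrite /Bx /Bz /Bpi -rmorphXn -rmorphM /=.
apply/eqP; rewrite -Quotient.idealrBE; apply/asboolP.
by exists 1; rewrite mul1r.
Qed.

End Danielewski.

(* Main.v *)
Require Import Defs.
From HB Require Import structures.
From mathcomp Require Import all_boot all_algebra.
From mathcomp Require Import boolp.
From mathcomp Require Import mpoly.
From mathcomp Require Import zify ring.

Set Implicit Arguments.
Unset Strict Implicit.
Unset Printing Implicit Defensive.

Import GRing.Theory.
Local Open Scope ring_scope.

(* Inside k[x, 1/x, y] order the monomials lexicographically, first by their
   degree in y.  As B is free over k[x] on the elements z^q y^r with r < m, which
   have the distinct y-degrees mq + r, the leading monomials of B are the products
   of powers of x, y and x^-n y^m (the leading monomial of z).  A derivation D of
   B has a leading part x^s y^t (alpha x d/dx + beta y d/dy), which multiplies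
   x^c y^d by (alpha c + beta d) x^s y^t.  If D is locally nilpotent and alpha is
   not 0, following x, y and z until they are killed makes alpha and beta
   multiples of a common weight by natural numbers, and n, m >= 2 makes this
   impossible; hence alpha = 0, and then D lowers the y-degree and kills x.

   Let d be the derivation with d x = 0 and d y = x^n, whose kernel is k[x].  As d
   is locally nilpotent, so are its conjugates by an automorphism and its inverse,
   hence both map x into k[x] and x goes to lambda x + c.  The conjugates have
   kernel k[x] too, whence y goes to mu y + g(x).  The rest is a comparison of
   coefficients in x^n P(lambda x + c, mu y + g) = (lambda x + c)^n x^n alpha(z):
   that of y^m gives c = 0, that of y^(m-1) gives x^n | g since f_(m-1) = 0, and
   the others give the congruences. *)

(** * Sizes and extreme coefficients in one variable *)

Lemma coef_geq_size (R : nzRingType) (p : {poly R}) i :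
  (size p <= i)%N -> p`_i = 0.
Proof. exact: nth_default. Qed.

Lemma coefM_top (R : nzRingType) (p q : {poly R}) a b :
  (size p <= a.+1)%N -> (size q <= b.+1)%N -> (p * q)`_(a + b)%N = p`_a * q`_b.
Proof.
move=> sp sq; rewrite coefM.
have lt_a : (a < (a + b).+1)%N by rewrite ltnS leq_addr.
rewrite (bigD1 (Ordinal lt_a)) //= addKn big1 ?addr0 // => j ne_ja.
have {}ne_ja : (j : nat) != a by apply: contra ne_ja => /eqP ja; apply/eqP/val_inj.
have [lt_ja|le_aj] := ltnP j a.
  by rewrite [q`__]coef_geq_size ?mulr0 //; lia.
by rewrite [p`_j]coef_geq_size ?mul0r //; lia.
Qed.

Lemma size_mul_top (R : nzRingType) (p q : {poly R}) a b :
  (size p <= a.+1)%N -> (size q <= b.+1)%N -> (size (p * q)%R <= (a + b).+1)%N.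
Proof. by move=> sp sq; have := size_polyMleq p q; lia. Qed.

Lemma size_deriv_leq (R : nzRingType) (p : {poly R}) n :
  (size p <= n.+1)%N -> (size p^`() <= n)%N.
Proof. by move=> sp; rewrite (leq_trans (size_poly _ _)) // -subn1 leq_subLR. Qed.

Lemma coef_maxn (R : nzRingType) (p q : {poly R}) :
    (p != 0) || (q != 0) ->
  let b := (maxn (size p) (size q)).-1 in (p`_b != 0) || (q`_b != 0).
Proof.
wlog le_pq : p q / (size p <= size q)%N => [IH pq0|pq0 /=].
  have [le|le] := orP (leq_total (size p) (size q)); first exact: IH.
  by rewrite /= maxnC orbC; apply: IH; rewrite // orbC.
rewrite (maxn_idPr le_pq) -/(lead_coef q) lead_coef_eq0.
case: (eqVneq q 0) pq0 => [q0|_ _]; last exact: orbT.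
rewrite orbF => p0; move: le_pq.
by rewrite q0 size_poly0 leqn0 size_poly_eq0 (negbTE p0).
Qed.

(** * Leading monomials in k[x][y] *)

Section Top.
Variable R : idomainType.
Implicit Types (p q : {poly {poly R}}) (v w : R).

(* All monomials x^i y^j of p satisfy (j, i) <= (b, a) lexicographically, and
   v, which may be 0, is the coefficient of x^a y^b. *)
Definition top p a b v :=
  [/\ (size p <= b.+1)%N, (size (p`_b)%R <= a.+1)%N & p`_b`_a = v].

Lemma topM p q a b c d v w :
  top p a b v -> top q c d w -> top (p * q) (a + c) (b + d) (v * w).
Proof.
move=> [sp sa <-] [sq sc <-].
by split; rewrite ?size_mul_top ?coefM_top ?size_mul_top.
Qed.

Lemma topD p q a b v w : top p a b v -> top q a b w -> top (p + q) a b (v + w).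
Proof.
move=> [sp sa <-] [sq sc <-]; split; rewrite ?coefD //.
  by rewrite (leq_trans (size_polyD _ _)) // geq_max sp.
by rewrite (leq_trans (size_polyD _ _)) // geq_max sa.
Qed.

Lemma topMn p a b v c : top p a b v -> top (p *+ c) a b (v *+ c).
Proof.
move=> [sp sa <-]; split; rewrite ?coefMn -1?scaler_nat //.
  by rewrite (leq_trans (size_scale_leq _ _)).
by rewrite (leq_trans (size_scale_leq _ _)).
Qed.

Lemma topN p a b v : top p a b v -> top (- p) a b (- v).
Proof. by move=> [sp sa <-]; split; rewrite ?coefN ?size_polyN ?coefN. Qed.

Lemma top_mulX p a b v : top p a b v -> top ('X%:P * p) a.+1 b v.
Proof.
move=> h; rewrite -add1n -[b]add0n -[v]mul1r; apply: topM _ h.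
by split; rewrite ?size_polyC_leq1 ?coefC /= ?size_polyX ?coefX.
Qed.

Lemma top_mulY p a b v : top p a b v -> top ('X * p) a b.+1 v.
Proof.
move=> h; rewrite -add1n -[a]add0n -[v]mul1r; apply: topM _ h.
by split; rewrite ?size_polyX ?coefX ?size_poly1 ?coef1.
Qed.

Lemma top_monomial a b : top (('X^a)%:P * 'X^b) a b 1.
Proof.
elim: b => [|b IHb]; last by rewrite exprS mulrCA; apply: top_mulY.
elim: a => [|a IHa].
  by rewrite mul1r; split; rewrite ?size_poly1 ?coef1 ?size_poly1 ?coef1.
by rewrite exprS polyCM -mulrA; apply: top_mulX.
Qed.

Lemma top_derivY p a b v : top p a b v -> top ('X * p^`()) a b (v *+ b).
Proof.
move=> [sp sa <-]; case: b => [|b] in sp sa *.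
  by rewrite (size1_polyC sp) derivC mulr0 mulr0n; split;
    rewrite ?coef0 ?size_poly0.
split; rewrite ?coefXM ?coef_deriv ?coefMn //=.
  rewrite (leq_trans (size_polyMleq _ _)) // size_polyX /=.
  by rewrite ltnS size_deriv_leq.
by rewrite -scaler_nat (leq_trans (size_scale_leq _ _)).
Qed.

Lemma top_derivX p a b v :
  top p a b v -> top ('X%:P * map_poly (@deriv R) p) a b (v *+ a).
Proof.
move=> [sp sa <-]; split.
- by rewrite mul_polyC (leq_trans (size_scale_leq _ _)) // (leq_trans (size_poly _ _)).
- rewrite coefCM coef_map /= (leq_trans (size_polyMleq _ _)) // size_polyX /=.
  by rewrite ltnS size_deriv_leq.
- rewrite coefCM coef_map coefXM; case: a sa => [|a] _ //=.
  by rewrite coef_deriv.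
Qed.

Lemma top_uniq p a b v c d w :
  top p a b v -> v != 0 -> top p c d w -> w != 0 -> a = c /\ b = d.
Proof.
move=> [sp sa <-] v0 [sq sc <-] w0.
have nzc (q : {poly R}) i : q`_i != 0 -> (i < size q)%N.
  by move=> ne; rewrite ltnNge; apply: contra ne => le; rewrite nth_default.
have nzc2 i : p`_i != 0 -> (i < size p)%N.
  by move=> ne; rewrite ltnNge; apply: contra ne => le; rewrite nth_default.
have pb : p`_b != 0 by apply: contraNneq v0 => ->; rewrite coef0.
have pd : p`_d != 0 by apply: contraNneq w0 => ->; rewrite coef0.
have bd : b = d by have := nzc2 _ pb; have := nzc2 _ pd; lia.
by subst d; split=> //; have := nzc _ _ v0; have := nzc _ _ w0; lia.
Qed.

Lemma top_exists p : p != 0 ->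
  top p (size (lead_coef p)).-1 (size p).-1 (lead_coef (lead_coef p)).
Proof. by move=> p0; split; rewrite ?leqSpred. Qed.

(** Both components of a derivation are to be measured in one common bidegree, where one of the two
    coefficients may vanish but not both. *)
Lemma top_exists2 p q : (p != 0) || (q != 0) ->
  exists a b v w, [/\ top p a b v, top q a b w & (v != 0) || (w != 0)].
Proof.
move=> /coef_maxn pq; set b := _.-1 in pq.
have := coef_maxn pq; set a := _.-1 => pqa.
exists a, b, p`_b`_a, q`_b`_a; split=> //.
- by split; rewrite // (leq_trans _ (leqSpred _)) // leq_maxl.
- by split; rewrite // (leq_trans _ (leqSpred _)) // leq_maxr.
Qed.

End Top.

(** * Evaluation and derivations *)

Lemma poly2_rmorph_ext (k S : nzRingType)
    (g h : {rmorphism {poly {poly k}} -> S}) :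
    (forall c, g c%:P%:P = h c%:P%:P) -> g 'X%:P = h 'X%:P -> g 'X = h 'X ->
  g =1 h.
Proof.
move=> ghC ghX ghY; elim/poly_ind => [|p u IHp]; first by rewrite !rmorph0.
rewrite !rmorphD !rmorphM ghY IHp; congr (_ + _).
elim/poly_ind: u => [|u c IHu]; first by rewrite polyC0 !rmorph0.
by rewrite !(polyCD, polyCM) !rmorphD !rmorphM ghC ghX IHu.
Qed.

Section Eval.
Variables (k : fieldType) (A : comAlgType k).
Implicit Types (x y : A) (p : {poly {poly k}}) (u : {poly k}).

(* p(x, y), where p is a polynomial in Y with coefficients in k[X]. *)
Definition ev x y : {rmorphism {poly {poly k}} -> A} :=
  horner_eval y \o map_poly (horner_alg x).

Lemma evC x y u : ev x y u%:P = horner_alg x u.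
Proof. by rewrite /= map_polyC /= horner_evalE hornerC. Qed.

Lemma evX x y : ev x y 'X%:P = x.
Proof. by rewrite evC horner_algX. Qed.

Lemma evY x y : ev x y 'X = y.
Proof. by rewrite /= map_polyX horner_evalE hornerX. Qed.

Lemma evA x y c : ev x y c%:P%:P = c%:A.
Proof. by rewrite evC horner_algC. Qed.

Lemma ev_initial (g : {rmorphism {poly {poly k}} -> A}) x y p :
  (forall c, g c%:P%:P = c%:A) -> g 'X%:P = x -> g 'X = y -> g p = ev x y p.
Proof.
by move=> gA gX gY; apply: poly2_rmorph_ext => [c||]; rewrite ?evA ?evX ?evY.
Qed.

(** Here X goes to [u] and Y to [q]; the coefficients are composed with [u] before Y is replaced, so
    [q] itself is not altered. *)
Definition subst u (q : {poly {poly k}}) :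
    {rmorphism {poly {poly k}} -> {poly {poly k}}} :=
  comp_poly q \o map_poly (comp_poly u).

Lemma subst_C u q c : subst u q c%:P = (c \Po u)%:P.
Proof. by rewrite /= map_polyC /= comp_polyC. Qed.

Lemma subst_Y u q : subst u q 'X = q.
Proof. by rewrite /= map_polyX comp_polyX. Qed.

Lemma ev_subst x y u q p :
  ev x y (subst u q p) = ev (horner_alg x u) (ev x y q) p.
Proof.
apply: (@ev_initial (ev x y \o subst u q)) => [c||].
- by rewrite -[LHS]/(ev x y (subst u q c%:P%:P)) subst_C comp_polyC evA.
- by rewrite -[LHS]/(ev x y (subst u q 'X%:P)) subst_C comp_polyX evC.
- by rewrite -[LHS]/(ev x y (subst u q 'X)) subst_Y.
Qed.

(** k-linearity is contained in the Leibniz rule and the vanishing on constants. *)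
Definition derivation (D : A -> A) :=
  [/\ {morph D : a b / a + b}, forall a b, D (a * b) = D a * b + a * D b
    & forall c, D c%:A = 0].

Lemma derivation0 D : derivation D -> D 0 = 0.
Proof. by case=> _ _ /(_ 0); rewrite scale0r. Qed.

Lemma derivationX D a n : derivation D -> D (a ^+ n) = a ^+ n.-1 * D a *+ n.
Proof.
case=> _ DM DA; elim: n => [|n IHn]; first by rewrite mulr0n expr0 -[1]scale1r DA.
rewrite exprS DM IHn /=; case: n {IHn} => [|n].
  by rewrite mulr0n mulr0 addr0 expr0 mulrC.
by rewrite -mulrnAr mulrA -exprS /= [D a * _]mulrC mulrnAr -mulrS.
Qed.

(** Chain rule: deriving the coefficients is d/dX, the outer derivative is d/dY. *)
Lemma derivation_ev D x y p : derivation D ->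
  D (ev x y p) = ev x y (map_poly (@deriv k) p) * D x + ev x y p^`() * D y.
Proof.
move=> dD; have [DD DM DA] := dD; have D0 := derivation0 dD.
have derC u : D (ev x y u%:P) = ev x y u^`()%:P * D x.
  elim/poly_ind: u => [|u c IHu]; first by rewrite deriv0 !rmorph0 mul0r D0.
  rewrite derivMXaddC !(polyCD, polyCM, rmorphD, rmorphM) DD DM IHu evX evA DA.
  by rewrite addr0; ring.
elim/poly_ind: p => [|p u IHp].
  by rewrite map_poly0 deriv0 !rmorph0 !mul0r D0 addr0.
have -> : map_poly (@deriv k) (p * 'X + u%:P)
    = map_poly (@deriv k) p * 'X + u^`()%:P.
  rewrite raddfD /= map_polyC /=; congr (_ + _).
  by apply/polyP => i; rewrite coef_map !coefMX coef_map; case: eqP; rewrite ?raddf0.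
rewrite derivMXaddC !(rmorphD, rmorphM) DD DM IHp derC evY; ring.
Qed.

End Eval.

Lemma lrmorph_ev (k : fieldType) (A B : comAlgType k)
    (g : {lrmorphism A -> B}) (x y : A) (p : {poly {poly k}}) :
  g (ev x y p) = ev (g x) (g y) p.
Proof.
apply: (@ev_initial k B (g \o ev x y)) => [c||].
- by rewrite -[LHS]/(g (ev x y c%:P%:P)) evA linearZ rmorph1.
- by rewrite -[LHS]/(g (ev x y 'X%:P)) evX.
- by rewrite -[LHS]/(g (ev x y 'X)) evY.
Qed.

(** * Derivatives, substitutions and powers of affine polynomials *)

Lemma size_deriv_pchar0 (R : idomainType) (p : {poly R}) :
  [pchar R] =i pred0 -> size p^`() = (size p).-1.
Proof.
move=> /pcharf0P R0; have [s1|s2] := leqP (size p) 1.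
  by rewrite (size1_polyC s1) derivC size_poly0 size_polyC; case: eqP.
have [s sE] : exists s, size p = s.+2 by case: (size p) s2 => [|[|s]] //; exists s.
have p0 : p`_s.+1 != 0.
  have := lead_coef_eq0 p; rewrite /lead_coef sE /= -size_poly_eq0 sE => ->.
  by [].
rewrite sE; apply/eqP; rewrite eqn_leq size_deriv_leq ?sE //= ltnNge.
apply/negP => le; have := coef_geq_size le.
rewrite coef_deriv -mulr_natr => /eqP; rewrite mulf_eq0 (negbTE p0) R0.
by [].
Qed.

Lemma pchar_poly0 (R : idomainType) : [pchar R] =i pred0 -> [pchar {poly R}] =i pred0.
Proof.
move=> /pcharf0P R0; apply/pcharf0P => n.
by rewrite -polyC_natr polyC_eq0 R0.
Qed.

Lemma coef_comp_scaleX (R : comNzRingType) (p : {poly R}) c i :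
  (p \Po (c *: 'X))`_i = p`_i * c ^+ i.
Proof.
rewrite coef_comp_poly.
under eq_bigr => l _ do rewrite exprZn coefZ coefXn.
have [lt|le] := ltnP i (size p); last first.
  rewrite coef_geq_size // mul0r big1 // => l _.
  by rewrite gtn_eqF ?mulr0 // (leq_trans (ltn_ord l)).
rewrite (bigD1 (Ordinal lt)) //= eqxx mulr1 big1 ?addr0 // => l ne.
case: eqP => [il|_]; last by rewrite !mulr0.
by case/negP: ne; apply/eqP/val_inj.
Qed.

(** Taylor expansion to first order; with [d] a multiple of x^n it reduces a substitution modulo
    x^n. *)
Lemma comp_poly_shift (R : comNzRingType) (p q d : {poly R}) :
  exists r, p \Po (q + d) = p \Po q + d * r.
Proof.
elim/poly_ind: p => [|p c [r IHp]]; first by exists 0; rewrite !comp_poly0 mulr0 addr0.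
exists (r * (q + d) + (p \Po q)).
rewrite !comp_poly_MXaddC IHp; ring.
Qed.

Lemma size_affine (R : nzRingType) (a b : R) :
  (size (a *: 'X + b%:P)%R <= 2)%N.
Proof.
rewrite (leq_trans (size_polyD _ _)) // geq_max.
rewrite (leq_trans (size_scale_leq _ _)) ?size_polyX //.
by rewrite (leq_trans (size_polyC_leq1 _)).
Qed.

Lemma size_affine_exp (R : nzRingType) (p : {poly R}) i :
  (size p <= 2)%N -> (size (p ^+ i)%R <= i.+1)%N.
Proof.
move=> sp; rewrite (leq_trans (size_poly_exp_leq _ _)) // ltnS -[leqRHS]mul1n.
by rewrite leq_mul // -subn1 leq_subLR.
Qed.

(** The two top terms of the binomial formula. *)
Lemma coef_affine_exp (R : comNzRingType) (a b : R) i :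
  ((a *: 'X + b%:P) ^+ i)`_i = a ^+ i /\
  ((a *: 'X + b%:P) ^+ i.+1)`_i = (a ^+ i * b) *+ i.+1.
Proof.
have top i' : ((a *: 'X + b%:P) ^+ i')`_i' = a ^+ i'.
  elim: i' => [|l IHl]; first by rewrite !expr0 coef1.
  have s1 := size_affine a b; have sl := size_affine_exp l s1.
  rewrite exprS -add1n (coefM_top s1 sl) IHl coefD coefZ coefX coefC /=.
  by rewrite addr0 mulr1 add1n exprS.
split=> //; elim: i => [|i IHi].
  by rewrite expr1 expr0 coefD coefZ coefX coefC /= mulr0 add0r mul1r.
rewrite exprS mulrDl coefD -scalerAl coefZ coefXM IHi coefCM top exprS.
by rewrite [RHS]mulrS mulrnAr addrC mulrA; congr (_ + _); rewrite mulrC.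
Qed.

Lemma size2_affine (R : nzRingType) (p : {poly R}) :
  (size p <= 2)%N -> p = p`_1 *: 'X + (p`_0)%:P.
Proof.
move=> sp; apply/polyP => -[|[|i]]; rewrite coefD coefZ coefX coefC /=.
- by rewrite mulr0 add0r.
- by rewrite mulr1 addr0.
- by rewrite mulr0 addr0 coef_geq_size // (leq_trans sp).
Qed.

(** * Integer weights *)

Lemma intr_eq0_pchar0 (k : fieldType) (i : int) :
  [pchar k] =i pred0 -> (i%:~R == 0 :> k) = (i == 0).
Proof.
move=> /pcharf0P k0; case: i => i; first by rewrite -pmulrn k0.
by rewrite NegzE mulrNz oppr_eq0 -pmulrn k0.
Qed.

(* Here i1, i2 and i3 are the numbers of steps after which the leading part of D
   kills the leading monomials of x, y and z, and (p, q) is its bidegree.  The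
   last four equations say that it maps x to the leading monomial of x^e y^f z^l,
   and y to that of x^e' y^f' z^l'. *)
Lemma no_homogeneous_nilpotent (n m i1 i2 i3 e f l e' f' l' : nat) (p q : int) :
    (2 <= n)%N -> (2 <= m)%N -> (0 < i1)%N ->
    1 + i1%:Z * p + i2%:Z * q = 0 -> - n%:Z * i1%:Z + m%:Z * i2%:Z = i3%:Z ->
    1 + p = e%:Z - n%:Z * l%:Z -> q = f%:Z + m%:Z * l%:Z ->
    p = e'%:Z - n%:Z * l'%:Z -> 1 + q = f'%:Z + m%:Z * l'%:Z -> False.
Proof.
move=> n2 m2 i1_gt0 pq i3E pE qE pE' qE'.
have i2_gt0 : (0 < i2)%N.
  have ni : (0 < n * i1)%N by rewrite muln_gt0 i1_gt0 ltnW.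
  by case: i2 i3E {pq} => // i3E; lia.
(* Let x, y, z have weights i1, i2, i3. Then (p, q) has weight -1, so the image of x has weight i1 -
   1 and that of y has weight i2 - 1. *)
have ex : e%:Z * i1%:Z + f%:Z * i2%:Z + l%:Z * i3%:Z = i1%:Z - 1.
  have -> : e%:Z = 1 + p + n%:Z * l%:Z by lia.
  have -> : f%:Z = q - m%:Z * l%:Z by lia.
  by rewrite -i3E -[RHS]addr0 -pq; ring.
have ey : e'%:Z * i1%:Z + f'%:Z * i2%:Z + l'%:Z * i3%:Z = i2%:Z - 1.
  have -> : e'%:Z = p + n%:Z * l'%:Z by lia.
  have -> : f'%:Z = 1 + q - m%:Z * l'%:Z by lia.
  by rewrite -i3E -[RHS]addr0 -pq; ring.
have {}ex : (e * i1 + f * i2 + l * i3 + 1 = i1)%N by lia.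
have {}ey : (e' * i1 + f' * i2 + l' * i3 + 1 = i2)%N by lia.
(* A factor x in the image of x, or y in that of y, would already be too heavy. *)
have e0 : e = 0%N by case: e ex {pE} => // e; rewrite mulSn; lia.
have f'0 : f' = 0%N by case: f' ey {qE'} => // f'; rewrite mulSn; lia.
have lt_l : (l < l')%N.
  rewrite ltnNge; apply/negP => le_l.
  have : (m * l' <= m * l)%N by rewrite leq_mul2l le_l orbT.
  by subst; lia.
(* With t = l' - l one gets f = m t - 1 and e' = n t - 1, both positive. Then [ex] yields i2 < i1
   and [ey] yields i1 < i2. *)
have [t l'E t1] : exists2 t, l' = (l + t)%N & (0 < t)%N.
  by exists (l' - l)%N; rewrite ?subn_gt0 // subnKC // ltnW.
have mt : (2 <= m * t)%N by rewrite (leq_mul m2 t1).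
have nt : (2 <= n * t)%N by rewrite (leq_mul n2 t1).
have f1 : (0 < f)%N by subst; lia.
have e1 : (0 < e')%N by subst; lia.
have : (i2 <= f * i2)%N by rewrite leq_pmull.
have : (i1 <= e' * i1)%N by rewrite leq_pmull.
lia.
Qed.

(** * The surface x^n z = P(x, y) *)

Section Surface.
Variables (k : fieldType) (n m : nat) (f : nat -> {poly k}).
Hypotheses (hchar : [pchar k] =i pred0) (hn : (2 <= n)%N) (hm : (2 <= m)%N).

(** P as a polynomial in Y over k[X], where it is monic. *)
Definition Pxy : {poly {poly k}} :=
  'X^m + \sum_(j < m.-1) (f j)%:P * 'X^j.

Lemma size_Pxy_tail :
  (size (\sum_(j < m.-1) (f j)%:P * 'X^j : {poly {poly k}})%R <= m.-1)%N.
Proof.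
apply: (leq_trans (size_sum _ _ _)); apply/bigmax_leqP => j _.
by rewrite mul_polyC (leq_trans (size_scale_leq _ _)) // size_polyXn.
Qed.

Lemma coef_Pxy i : Pxy`_i = (i == m)%:R + (if (i < m.-1)%N then f i else 0).
Proof.
rewrite coefD coefXn; congr (_ + _); rewrite coef_sum.
under eq_bigr => j _ do rewrite coefCM coefXn.
case: ltnP => [lt_i|le_i]; last first.
  rewrite big1 // => j _; case: eqP => [ij|_]; last by rewrite mulr0.
  by have := ltn_ord j; rewrite -ij ltnNge le_i.
rewrite (bigD1 (Ordinal lt_i)) //= eqxx mulr1 big1 ?addr0 // => j ne_j.
case: eqP => [ij|_]; last by rewrite mulr0.
by case/negP: ne_j; apply/eqP/val_inj.
Qed.

Lemma size_Pxy : size Pxy = m.+1.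
Proof.
rewrite size_polyDl size_polyXn //.
by rewrite (leq_ltn_trans size_Pxy_tail) // ltnS leq_pred.
Qed.

Lemma Pxy_monic : Pxy \is monic.
Proof.
rewrite monicE lead_coefDl ?lead_coefXn // size_polyXn.
by rewrite (leq_ltn_trans size_Pxy_tail) // ltnS leq_pred.
Qed.

Variables (B : comAlgType k) (x y z : B).
Implicit Types g p q : {poly {poly k}}.
Local Notation j := (ev x y).
Hypotheses (j_inj : injective j) (xz : x ^+ n * z = j Pxy).
(** Induction form of the fact that x, y and z generate the algebra B. *)
Hypothesis B_ind : forall W : B -> Prop,
  W 1 -> (forall c a b, W a -> W b -> W (c *: a + b)) ->
  (forall b, W b -> [/\ W (x * b), W (y * b) & W (z * b)]) -> forall b, W b.

(** * Normal forms over k[x] *)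

(* Seen in k[x, 1/x, y], nf_base i has degree i in y. *)
Definition nf_base i := z ^+ (i %/ m) * y ^+ (i %% m).
Definition nf (g : {poly {poly k}}) :=
  \sum_(i < size g) horner_alg x g`_i * nf_base i.

Lemma nfE L (g : {poly {poly k}}) : (size g <= L)%N ->
  nf g = \sum_(i < L) horner_alg x g`_i * nf_base i.
Proof.
move=> sL; rewrite /nf (big_ord_widen L (fun i => horner_alg x g`_i * nf_base i) sL).
rewrite big_mkcond; apply: eq_bigr => i _; case: ltnP => // le.
by rewrite coef_geq_size // rmorph0 mul0r.
Qed.

Lemma nf_linear u g h : nf (u *: g + h) = horner_alg x u * nf g + nf h.
Proof.
pose L := maxn (size (u *: g + h)%R) (maxn (size g) (size h)).
rewrite !(@nfE L) /L ?leq_max ?leqnn ?orbT // mulr_sumr -big_split /=.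
by apply: eq_bigr => i _; rewrite coefD coefZ rmorphD rmorphM mulrDl mulrA.
Qed.

Lemma nfXn i : nf 'X^i = nf_base i.
Proof.
rewrite /nf size_polyXn big_ord_recr /= coefXn eqxx rmorph1 mul1r.
rewrite big1 ?add0r // => l _; rewrite coefXn ltn_eqF //.
by rewrite rmorph0 mul0r.
Qed.

(** The k[x]-span of the [nf_base i] contains 1 and is stable under x, y and z: when multiplication
    by y produces y^m, this is rewritten as x^n z minus the lower terms of P. *)
Lemma nf_surj b : exists g, b = nf g.
Proof.
have hx c : horner_alg x c%:P = c%:A by rewrite horner_algC.
have WD a a1 : (exists g, a = nf g) -> (exists g, a1 = nf g) ->
    exists g, a + a1 = nf g.
  by move=> [g ->] [h ->]; exists (1 *: g + h); rewrite nf_linear rmorph1 mul1r.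
have WZ u a : (exists g, a = nf g) -> exists g, horner_alg x u * a = nf g.
  move=> [g ->]; exists (u *: g + 0).
  by rewrite nf_linear [nf 0]big1 ?addr0 // => i _; rewrite coef0 rmorph0 mul0r.
have WS L (F : 'I_L -> B) : (forall i, exists g, F i = nf g) ->
    exists g, \sum_(i < L) F i = nf g.
  elim: L F => [|L IHL] F WF; last first.
    by rewrite big_ord_recr; apply: (WD) => //; apply: IHL.
  by exists 0; rewrite big_ord0 /nf size_poly0 big_ord0.
have Wb i : exists g, nf_base i = nf g by exists 'X^i; rewrite nfXn.
have m0 : (0 < m)%N by apply: ltnW.
have Wzy (q r : nat) : (r < m)%N -> exists g, z ^+ q * y ^+ r = nf g.
  move=> lt_r; exists 'X^(q * m + r); rewrite nfXn /nf_base.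
  by rewrite divnMDl // modnMDl divn_small // modn_small // addn0.
move: b; apply: B_ind => [|c a a1 Wa Wa1|a [g ->]].
- by exists 'X^0; rewrite nfXn /nf_base div0n mod0n mulr1.
- by apply: (WD) => //; rewrite -mulr_algl -hx; apply: (WZ).
split.
- by rewrite -[X in X * _](horner_algX x); apply: (WZ); exists g.
- rewrite mulr_sumr; apply: (WS) => i.
  rewrite mulrCA; apply: (WZ); rewrite /nf_base mulrCA -exprS.
  have := ltn_pmod i m0; rewrite leq_eqVlt => /orP [/eqP ->|]; last exact: Wzy.
  have -> : y ^+ m = x ^+ n * z + \sum_(i < m.-1) horner_alg x (- f i) * y ^+ i.
    rewrite xz rmorphD rmorph_sum rmorphXn evY -addrA -big_split.
    rewrite big1 ?addr0 // => l _.
    by rewrite rmorphM rmorphXn evC evY rmorphN mulNr /= addrN.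
  rewrite mulrDr; apply: (WD).
    rewrite mulrCA -exprSr -[X in X ^+ n](horner_algX x) -rmorphXn.
    by apply: (WZ); have := Wzy (i %/ m).+1 0%N m0; rewrite mulr1.
  rewrite mulr_sumr; apply: (WS) => l.
  rewrite mulrCA; apply: (WZ); apply: Wzy.
  by rewrite (leq_trans (ltn_ord l)) ?leq_pred.
- rewrite mulr_sumr; apply: (WS) => i.
  by rewrite mulrCA; apply: (WZ); rewrite /nf_base mulrA -exprS; apply/Wzy/ltn_pmod.
Qed.

(** This is x^(ns) times [nf_base i] as a polynomial in x and y: each factor z absorbs x^n and
    becomes P. In [cleared] the choice s = [size g] is large enough for all terms at once. *)
Definition cleared_base s i : {poly {poly k}} :=
  ('X ^+ (n * (s - i %/ m)))%:P * (Pxy ^+ (i %/ m) * 'X^(i %% m)).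

Definition cleared (g : {poly {poly k}}) :=
  \sum_(i < size g) (g`_i)%:P * cleared_base (size g) i.

Lemma ev_cleared_base s i :
  (i %/ m <= s)%N -> x ^+ (n * s) * nf_base i = j (cleared_base s i).
Proof.
move=> le_s; rewrite !(rmorphM, rmorphXn) evX evY -xz exprMn.
rewrite -[in LHS](subnK le_s) mulnDr exprD -!mulrA; congr (_ * _).
by rewrite exprM.
Qed.

Lemma ev_cleared g : x ^+ (n * size g) * nf g = j (cleared g).
Proof.
rewrite rmorph_sum mulr_sumr; apply: eq_bigr => i _.
rewrite rmorphM evC -ev_cleared_base 1?mulrCA //.
by rewrite (leq_trans (leq_div _ _)) // ltnW.
Qed.

Lemma monic_cleared_base i : Pxy ^+ (i %/ m) * 'X^(i %% m) \is monic.
Proof. by rewrite monicMr ?monicXn // monic_exp // Pxy_monic. Qed.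

Lemma size_cleared_base_monic i :
  size (Pxy ^+ (i %/ m) * 'X^(i %% m)) = i.+1.
Proof.
rewrite size_Mmonic ?monicXn ?monic_neq0 ?monic_exp ?Pxy_monic //.
rewrite size_polyXn addnS /= polySpred ?monic_neq0 ?monic_exp ?Pxy_monic //.
by rewrite size_exp size_Pxy /= addSn mulnC -divn_eq.
Qed.

(** Each [cleared_base s i] is a power of x times a polynomial monic of degree i in y, so the top
    term of [g] cannot cancel. *)
Lemma size_lead_cleared g :
  size (cleared g) = size g /\
  lead_coef (cleared g)
    = lead_coef g * 'X ^+ (n * (size g - (size g).-1 %/ m)).
Proof.
have szE s i (c : {poly k}) : (size (c%:P * cleared_base s i)%R <= i.+1)%N.
  rewrite mulrA -rmorphM mul_polyC (leq_trans (size_scale_leq _ _)) //.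
  by rewrite size_cleared_base_monic.
have [->|g0] := eqVneq g 0.
  by rewrite /cleared lead_coef0 mul0r size_poly0 big_ord0 size_poly0 lead_coef0.
have [s sg] : exists s, size g = s.+1 by exists (size g).-1; apply: polySpred.
have gs0 : g`_s != 0.
  by have := lead_coef_eq0 g; rewrite /lead_coef sg /= => ->.
rewrite /cleared /lead_coef sg big_ord_recr /=.
set T := _%:P * cleared_base _ _; set S := \sum_(_ < _) _.
have sS : (size S <= s)%N.
  apply: (leq_trans (size_sum _ _ _)); apply/bigmax_leqP => i _.
  by rewrite (leq_trans (szE _ _ _)).
have X0 : ('X : {poly k}) ^+ (n * (s.+1 - s %/ m)) != 0.
  by rewrite expf_eq0 polyX_eq0 andbF.
have ET : T = (g`_s * 'X ^+ (n * (s.+1 - s %/ m)))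
    *: (Pxy ^+ (s %/ m) * 'X^(s %% m)).
  by rewrite -mul_polyC polyCM -mulrA.
have sT : size T = s.+1.
  by rewrite ET size_scale ?mulf_neq0 // size_cleared_base_monic.
rewrite addrC size_polyDl ?sT //; split=> //=.
rewrite coefD [S`_s]coef_geq_size // addr0 ET coefZ.
have /monicP := monic_cleared_base s.
by rewrite /lead_coef size_cleared_base_monic /= => ->; rewrite mulr1.
Qed.

(** Multiplication by a power of x moves an equation of B into k[X][Y]. *)
Lemma nf_compare R g p : j R * nf g = j p ->
  ('X ^+ (n * size g))%:P * p = R * cleared g.
Proof.
move=> e; apply: j_inj; rewrite !(rmorphM, rmorphXn) evX -e.
by rewrite -ev_cleared mulrCA.
Qed.

Lemma size_nf r g p : r != 0 -> horner_alg x r * nf g = j p -> size g = size p.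
Proof.
rewrite -(evC x y) => r0 /nf_compare /(congr1 (fun q : {poly {poly k}} => size q)).
have X0 : ('X : {poly k}) ^+ (n * size g) != 0 by rewrite expf_eq0 polyX_eq0 andbF.
by rewrite !mul_polyC !size_scale // (size_lead_cleared g).1 => ->.
Qed.

(** With denominators cleared the product lies in the domain k[X][Y]. *)
Lemma ev_regular R b : R != 0 -> j R * b = 0 -> b = 0.
Proof.
have [g ->] := nf_surj b; move=> R0.
rewrite -[X in _ = X -> _](rmorph0 j) => /nf_compare /esym/eqP.
rewrite mulr0 mulf_eq0 (negbTE R0) /= -size_poly_eq0 (size_lead_cleared g).1.
by rewrite size_poly_eq0 => /eqP ->; rewrite /nf size_poly0 big_ord0.
Qed.

Lemma nf_small g : (size g <= m)%N -> nf g = j g.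
Proof.
move=> sg; rewrite -[g in RHS]coefK poly_def rmorph_sum; apply: eq_bigr => i _.
rewrite -mul_polyC rmorphM rmorphXn evC evY /nf_base.
have lt_im : (i < m)%N by apply: leq_trans sg.
by rewrite divn_small // modn_small // mul1r.
Qed.

(** * Leading monomials of elements of B *)

(* v, which may be 0, is the coefficient of x^c y^d in h, seen in k[x, 1/x, y],
   and all monomials x^i y^j of h satisfy (j, i) <= (d, c). *)
Definition lead (h : B) (c d : int) (v : k) :=
  exists N M p a b, [/\ x ^+ N * y ^+ M * h = j p, top p a b v,
    c = a%:Z - N%:Z & d = b%:Z - M%:Z].

Lemma lead_neq0 h c d v : lead h c d v -> v != 0 -> h != 0.
Proof.
move=> [N [M [p [a [b [e [_ _ <-] _ _]]]]]] v0.
apply: contraNneq v0 => h0; move: e; rewrite h0 mulr0 -(rmorph0 j).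
by move/j_inj <-; rewrite !coef0.
Qed.

Lemma leadE c d : lead (x ^+ c * y ^+ d) c d 1.
Proof.
exists 0%N, 0%N, (('X^c)%:P * 'X^d), c, d; rewrite !subr0; split=> //.
  by rewrite mul1r mul1r !(rmorphM, rmorphXn) evX evY.
exact: top_monomial.
Qed.

Lemma lead_z : lead z (- n%:Z) m 1.
Proof.
exists n, 0%N, Pxy, 0%N, m; rewrite sub0r subr0 mulr1 xz.
have cm : Pxy`_m = 1 by rewrite coef_Pxy eqxx ltnNge leq_pred addr0.
by split=> //; split; rewrite ?cm ?size_poly1 ?coef1 ?size_Pxy.
Qed.

(** The top term of the normal form of [h] has y-degree ml + q with q < m, hence comes from x^e z^l
    y^q; clearing denominators only shifts the bidegree. *)
Lemma lead_mem h c d v : lead h c d v -> v != 0 ->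
  exists e q l : nat, c = e%:Z - n%:Z * l%:Z /\ d = q%:Z + m%:Z * l%:Z.
Proof.
have [g ->] := nf_surj h.
move=> [N [M [p [a [b [e tp -> ->]]]]]] v0.
have {}e : j (('X^N)%:P * 'X^M) * nf g = j p.
  by rewrite -e !(rmorphM, rmorphXn) evX evY.
have t1 := topM (top_monomial k (n * size g) 0) tp.
have := nf_compare e; have [sg lg] := size_lead_cleared g.
have [g0|g0] := eqVneq (cleared g) 0.
  rewrite g0 mulr0 => /eqP; rewrite mulf_eq0 polyC_eq0 expf_eq0 polyX_eq0 andbF /=.
  by move=> /eqP p0; case: tp v0 => _ _ <-; rewrite p0 !coef0 eqxx.
have t2 := topM (top_monomial k N M) (top_exists g0).
move=> E; move: t1; rewrite mulr1 E => t1.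
have [||aE bE] := top_uniq t1 _ t2 _; rewrite ?mul1r ?lead_coef_eq0 //.
have gg0 : g != 0 by rewrite -size_poly_eq0 -sg size_poly_eq0.
exists (size (lead_coef g)).-1, ((size g).-1 %% m)%N, ((size g).-1 %/ m)%N.
have lg0 : lead_coef g != 0 by rewrite lead_coef_eq0.
move: aE bE; rewrite lg sg size_mul // ?expf_eq0 ?polyX_eq0 ?andbF //.
rewrite size_polyXn addnS /= (polySpred lg0) addSn /=.
have le_s : ((size g).-1 %/ m <= size g)%N.
  by rewrite (leq_trans (leq_div _ _)) ?leq_pred.
rewrite mulnBr; have := leq_mul (leqnn n) le_s.
have := divn_eq (size g).-1 m.
move: (size g) ((size g).-1 %/ m)%N ((size g).-1 %% m)%N => s t r.
move: (size (lead_coef g)) => l; nia.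
Qed.

(** * Leading parts of derivations *)

Section Derivation.
Variables (D : B -> B) (dD : derivation D) (L : nat) (pX pY : {poly {poly k}}).
Hypotheses (DxE : x ^+ L * D x = j pX) (DyE : x ^+ L * D y = j pY).
Variables (a0 b0 : nat) (alpha beta : k).
(** In terms of x d/dx and y d/dy the coefficients of D are y [pX] and x [pY] over x^(L+1) y. Hence
    the extra factors here and the shifts by 1 in [s] and [t]. *)
Hypotheses (top_pX : top ('X * pX) a0 b0 alpha)
  (top_pY : top ('X%:P * pY) a0 b0 beta).

Let s : int := a0%:Z - L%:Z - 1.
Let t : int := b0%:Z - 1.

(* The leading part of D is x^s y^t (alpha x d/dx + beta y d/dy). *)
Lemma lead_derivation h c d v : lead h c d v ->
  lead (D h) (c + s) (d + t) (v * (alpha * c%:~R + beta * d%:~R)).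
Proof.
move=> [N [M [p [a [b [e tp -> ->]]]]]].
have [DD DM _] := dD.
(* The numerator of D h over x^(N+L+1) y^(M+1); the terms in N and M come from deriving the
   denominator x^N y^M of [h]. *)
pose G := 'X * pX * ('X%:P * map_poly (@deriv k) p - p *+ N)
  + 'X%:P * pY * ('X * p^`() - p *+ M).
exists (N + L).+1, M.+1, G, (a0 + a)%N, (b0 + b)%N; split; last by rewrite /t; lia.
- have DX u i : u * D (u ^+ i) = u ^+ i * D u *+ i.
    rewrite derivationX //; case: i => [|i]; first by rewrite !mulr0n mulr0.
    by rewrite mulrnAr mulrA -exprS.
  have := congr1 D e; rewrite !DM (derivation_ev _ _ _ dD) => De.
  have EX : x ^+ L * x * y * (D (x ^+ N) * y ^+ M * h)
      = j pX * y * (x ^+ N * y ^+ M * h) *+ N.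
    transitivity (x ^+ L * y * y ^+ M * h * (x * D (x ^+ N))); first by ring.
    by rewrite DX -DxE; ring.
  have EY : x ^+ L * x * y * (x ^+ N * D (y ^+ M) * h)
      = j pY * x * (x ^+ N * y ^+ M * h) *+ M.
    transitivity (x ^+ L * x * x ^+ N * h * (y * D (y ^+ M))); first by ring.
    by rewrite DX -DyE; ring.
  rewrite e in EX EY.
  rewrite /G !(rmorphD, rmorphM, rmorphB, rmorphMn) evX evY.
  transitivity (x ^+ L * x * y * (x ^+ N * y ^+ M * D h)).
    rewrite exprS exprD exprS.
    by move: (x ^+ N) (x ^+ L) (y ^+ M) (D h) => u1 u2 u3 u4; ring.
  have -> : x ^+ N * y ^+ M * D h
      = j (map_poly (@deriv k) p) * D x + j p^`() * D y
        - D (x ^+ N) * y ^+ M * h - x ^+ N * D (y ^+ M) * h by rewrite -De; ring.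
  by rewrite mulrBr mulrBr EX EY -DxE -DyE; ring.
- have tX := topM top_pX (topD (top_derivX tp) (topN (topMn N tp))).
  have tY := topM top_pY (topD (top_derivY tp) (topN (topMn M tp))).
  have := topD tX tY; rewrite -/G; congr (top _ _ _ _).
  have intrBn (i l : nat) : (i%:Z - l%:Z)%:~R = i%:R - l%:R :> k.
    by rewrite intrB.
  by rewrite !intrBn; ring.
- by rewrite /s; lia.
Qed.

(** As long as the factors of [lead_derivation] are nonzero, the iterates keep a nonzero leading
    coefficient; so one factor must vanish. *)
Lemma lead_nilpotent r h c d v : lead h c d v -> v != 0 -> iter r D h = 0 ->
  exists i : nat, alpha * (c + i%:Z * s)%:~R + beta * (d + i%:Z * t)%:~R = 0.
Proof.
elim: r h c d v => [|r IHr] h c d v hl v0.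
  by move=> h0; have := lead_neq0 hl v0; rewrite [h]h0 eqxx.
rewrite iterSr => Dr0.
have [E|ne] := eqVneq (alpha * c%:~R + beta * d%:~R) 0.
  by exists 0%N; rewrite !mul0r !addr0.
have [i Ei] := IHr _ _ _ _ (lead_derivation hl) (mulf_neq0 v0 ne) Dr0.
exists i.+1; rewrite -Ei; congr (_ * _%:~R + _ * _%:~R); lia.
Qed.

Hypothesis (D_nil : forall h, exists r, iter r D h = 0).

Lemma leading_weights : alpha != 0 \/ beta != 0 -> alpha = 0 /\ b0 = 0%N.
Proof.
move=> ab0.
have zero h c d : lead h c d 1 ->
    exists i : nat, alpha * (c + i%:Z * s)%:~R + beta * (d + i%:Z * t)%:~R = 0.
  have [r Dr] := D_nil h => hl.
  exact: (lead_nilpotent hl (oner_neq0 _) Dr).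
have lx : lead x 1 0 1 by have := leadE 1 0; rewrite mulr1.
have ly : lead y 0 1 1 by have := leadE 0 1; rewrite mul1r.
have intr_eq0 := fun i => @intr_eq0_pchar0 k i hchar.
have [i1 E1] := zero _ _ _ lx; have [i2 E2] := zero _ _ _ ly.
have [i3 E3] := zero _ _ _ lead_z.
have [alpha0|alpha0] := eqVneq alpha 0.
  split=> //; have beta0 : beta != 0 by case: ab0; rewrite // alpha0 eqxx.
  (* Now 1 + i2 t = 0, so t is negative and b0 = 0. *)
  move/eqP: E2; rewrite alpha0 mul0r add0r mulf_eq0 (negbTE beta0) intr_eq0 /=.
  move=> /eqP it; have [//|b0_gt0] := posnP b0.
  have tE : t = (b0.-1)%:Z by rewrite /t; lia.
  by move: it; rewrite tE -PoszM; lia.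
have castE (i : nat) (a b : int) :
    (a + i%:Z * b)%:~R = a%:~R + i%:~R * b%:~R :> k by rewrite intrD intrM.
rewrite !castE in E1 E2 E3.
(* [w] is the change of the factor from one iterate to the next. By [E1] and [E2], alpha = - i1 w
   and beta = - i2 w; dividing by [w] then gives integer identities, as the characteristic is
   zero. *)
exfalso; have [w wE] : exists w, w = alpha * s%:~R + beta * t%:~R by eexists.
have alphaE : alpha = - (i1%:~R * w).
  by apply/eqP; rewrite -addr_eq0 -E1 wE; apply/eqP; ring.
have betaE : beta = - (i2%:~R * w).
  by apply/eqP; rewrite -addr_eq0 -E2 wE; apply/eqP; ring.
have w0 : w != 0 by apply: contraNneq alpha0 => w0; rewrite alphaE w0 mulr0 oppr0.
have st : 1 + i1%:Z * s + i2%:Z * t = 0.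
  apply/eqP; rewrite -intr_eq0 -(mulIr_eq0 _ (mulIf w0)); apply/eqP.
  by rewrite !castE !mulrDl mul1r {1}wE {1}alphaE {1}betaE; ring.
have i3E : - n%:Z * i1%:Z + m%:Z * i2%:Z = i3%:Z.
  apply/eqP; rewrite eq_sym -subr_eq0 -intr_eq0 -(mulIr_eq0 _ (mulIf w0)); apply/eqP.
  rewrite -E3 intrB intrD !intrM intrN.
  transitivity (i3%:~R * (alpha * s%:~R + beta * t%:~R) + alpha * (- n%:~R)
    + beta * m%:~R).
    by rewrite -wE [in RHS]alphaE [in RHS]betaE; ring.
  by ring.
have i1_gt0 : (0 < i1)%N.
  case: i1 alphaE {E1 st i3E} => // alphaE.
  by move: alpha0; rewrite alphaE mul0r oppr0 eqxx.
have i2_gt0 : (0 < i2)%N.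
  have ni : (0 < n * i1)%N by rewrite muln_gt0 i1_gt0 ltnW.
  by case: i2 i3E {E2 betaE st} => // i3E; lia.
have beta0 : beta != 0.
  by rewrite betaE oppr_eq0 mulf_neq0 // intr_eq0 -lt0n.
(* D x and D y have leading coefficients alpha and beta, both nonzero, so their bidegrees are
   leading monomials of B. *)
have lx0 : 1 * (alpha * 1%:~R + beta * 0%:~R) != 0 :> k.
  by rewrite mulr0 addr0 mul1r mulr1.
have ly0 : 1 * (alpha * 0%:~R + beta * 1%:~R) != 0 :> k.
  by rewrite mulr0 add0r mul1r mulr1.
have [e [f1 [l [E F]]]] := lead_mem (lead_derivation lx) lx0.
have [e' [f1' [l' [E' F']]]] := lead_mem (lead_derivation ly) ly0.
rewrite add0r in F; rewrite add0r in E'.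
exact: (no_homogeneous_nilpotent hn hm i1_gt0 st i3E E F E' F').
Qed.

End Derivation.

Lemma locally_nilpotent_x D :
  derivation D -> (forall h, exists r, iter r D h = 0) -> D x = 0.
Proof.
move=> dD D_nil.
have [[g DxE] [h DyE]] := (nf_surj (D x), nf_surj (D y)).
pose L := (n * size g + n * size h)%N.
pose pX := ('X ^+ (n * size h))%:P * cleared g.
pose pY := ('X ^+ (n * size g))%:P * cleared h.
have DpX : x ^+ L * D x = j pX.
  by rewrite !(rmorphM, rmorphXn) evX -ev_cleared -DxE /L addnC exprD mulrA.
have DpY : x ^+ L * D y = j pY.
  by rewrite !(rmorphM, rmorphXn) evX -ev_cleared -DyE /L exprD mulrA.
have X0 : ('X%:P : {poly {poly k}}) != 0 by rewrite polyC_eq0 polyX_eq0.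
have pX0 : pX = 0 -> D x = 0.
  move=> pX0; apply: (@ev_regular ('X%:P ^+ L)).
    by rewrite expf_eq0 (negbTE X0) andbF.
  by rewrite rmorphXn evX DpX pX0 rmorph0.
have [/andP [pXE _]|ne] := boolP (('X * pX == 0) && ('X%:P * pY == 0)).
  by apply/pX0/eqP; move: pXE; rewrite mulf_eq0 polyX_eq0.
rewrite negb_and in ne.
have [a0 [b0 [alpha [beta [tX tY ab]]]]] := top_exists2 ne.
have [alpha0 b00] := leading_weights dD DpX DpY tX tY D_nil (orP ab).
(* Since b0 = 0, the product y [pX] has degree 0 in y, which leaves only [pX] = 0. *)
apply: pX0; apply/eqP; apply: contraT => pX0.
case: tX; rewrite b00 size_mul ?polyX_eq0 // size_polyX => sX _ _.
by move: sX; rewrite /= ltnS leqn0 size_poly_eq0 (negbTE pX0).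
Qed.

(** * The derivation d and its conjugates *)

Variables (d : B -> B) (dd : derivation d) (dx : d x = 0) (dy : d y = x ^+ n).

Lemma d_ev p : d (j p) = j p^`() * x ^+ n.
Proof. by rewrite (derivation_ev _ _ _ dd) dx dy mulr0 add0r. Qed.

Lemma d_horner u : d (horner_alg x u) = 0.
Proof. by rewrite -(evC x y) d_ev derivC rmorph0 mul0r. Qed.

Lemma d_mulX N h : d (x ^+ N * h) = x ^+ N * d h.
Proof.
by have [_ -> _] := dd; rewrite (derivationX _ _ dd) dx mulr0 mul0rn mul0r add0r.
Qed.

Lemma ev_regularX N h : x ^+ N * h = 0 -> h = 0.
Proof.
rewrite -(evX x y) -rmorphXn; apply: ev_regular.
by rewrite expf_eq0 polyC_eq0 polyX_eq0 andbF.
Qed.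

(** On k[x, y], d is x^n d/dy and lowers the y-degree; it commutes with the power of x that clears
    denominators. *)
Lemma d_nilpotent h : exists r, iter r d h = 0.
Proof.
have [g hE] := nf_surj h; have := ev_cleared g; rewrite -hE.
move: (n * size g)%N (cleared g) => N p e {g hE}.
have [s sp] : exists s, (size p <= s)%N by exists (size p).
elim: s h p sp e => [|s IHs] h p sp e.
  exists 0%N; move: sp e; rewrite leqn0 size_poly_eq0 => /eqP ->.
  by rewrite rmorph0; apply: ev_regularX.
have [||r Er] := IHs (d h) (('X ^+ n)%:P * p^`()).
- by rewrite mul_polyC (leq_trans (size_scale_leq _ _)) // size_deriv_leq.
- by rewrite -d_mulX e d_ev !(rmorphM, rmorphXn) evX mulrC.
- by exists r.+1; rewrite iterSr.
Qed.

(** In characteristic zero the cleared form of [h] has y-degree 0, and the normal form has the same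
    degree. *)
Lemma ker_d h : d h = 0 -> exists u, h = horner_alg x u.
Proof.
have [g ->] := nf_surj h => dh.
have : d (x ^+ (n * size g) * nf g) = 0 by rewrite d_mulX dh mulr0.
rewrite ev_cleared d_ev mulrC => /ev_regularX; rewrite -(rmorph0 j) => /j_inj.
move/(congr1 (fun p : {poly {poly k}} => size p)).
rewrite size_deriv_pchar0; last exact: pchar_poly0.
rewrite size_poly0 (size_lead_cleared g).1 => sg0.
have sg : (size g <= 1)%N by case: (size g) sg0 => [|[]].
exists g`_0; rewrite -(evC x y) -(size1_polyC sg) nf_small //.
exact: leq_trans sg (ltnW hm).
Qed.

Lemma conj_derivation (al be : {lrmorphism B -> B}) :
  cancel be al -> derivation (al \o d \o be).
Proof.
move=> beK; have [dD dM dA] := dd; split=> [a b|a b|c] /=.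
- by rewrite rmorphD dD rmorphD.
- by rewrite rmorphM dM rmorphD !rmorphM /= !beK.
- by rewrite linearZ rmorph1 dA rmorph0.
Qed.

(** The conjugate of d by [al] is locally nilpotent, so it kills x; that is, d kills [be x]. *)
Lemma conj_kills_x (al be : {lrmorphism B -> B}) :
  cancel al be -> cancel be al -> exists u, be x = horner_alg x u.
Proof.
move=> alK beK; have dD := conj_derivation beK.
have iterD r h : iter r (al \o d \o be) h = al (iter r d (be h)).
  by elim: r => [|r IHr]; rewrite ?beK // iterS IHr /= alK.
apply/ker_d/(can_inj alK); rewrite rmorph0.
apply: (locally_nilpotent_x dD) => h.
by have [r Er] := d_nilpotent (be h); exists r; rewrite iterD Er rmorph0.
Qed.

(** * Images of x and y under an automorphism *)

Section Automorphism.
Variables (al be : {lrmorphism B -> B}) (alK : cancel al be) (beK : cancel be al).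

Lemma aut_horner (g : {lrmorphism B -> B}) u v :
  g x = horner_alg x u -> g (horner_alg x v) = horner_alg x (v \Po u).
Proof.
move=> gx; rewrite -(evC x y) lrmorph_ev gx evC -(evC _ y v).
by rewrite -[in LHS](evY x y) -ev_subst subst_C evC.
Qed.

Lemma horner_alg_inj : injective (horner_alg x).
Proof. by move=> u v; rewrite -!(evC x y) => /j_inj/polyC_inj. Qed.

(** On k[x], [al] and [be] substitute polynomials that are inverse under composition, so their
    degrees multiply to 1. *)
Lemma aut_x : exists u, al x = horner_alg x u /\ size u = 2.
Proof.
have [u au] := conj_kills_x beK alK; have [w bw] := conj_kills_x alK beK.
exists u; split=> //; have : be (al x) = x by rewrite alK.
rewrite au (aut_horner _ bw) -{2}(horner_algX x) => /horner_alg_inj.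
move/(congr1 (fun p : {poly k} => (size p).-1)).
rewrite size_comp_poly size_polyX /= => /eqP; rewrite muln_eq1 => /andP[/eqP su _].
by case: (size u) su => [|[|[]]].
Qed.

Lemma aut_y_affine : exists g, al y = j g /\ size g = 2.
Proof.
have [u [au su]] := aut_x; have [w bw] := conj_kills_x alK beK.
pose D := al \o d \o be; have dD : derivation D by apply: conj_derivation.
have Dx : D x = 0 by rewrite /D /= bw d_horner rmorph0.
have Dy : D (al y) = horner_alg x (u ^+ n).
  by rewrite /D /= alK dy !rmorphXn /= au.
have [g gE] := nf_surj (al y); have [g' g'E] := nf_surj (D y).
(* As D kills x, the chain rule says that the y-derivative of [al y] times D y is u(x)^n. Cleared of
   denominators, both factors must have degree 0 in y. *)
have E : j (cleared g)^`() * j (cleared g')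
    = j (('X ^+ (n * size g) * 'X ^+ (n * size g') * u ^+ n)%:P).
  rewrite -ev_cleared -g'E mulrCA -[j _ * D y]add0r.
  have -> : 0 = j (map_poly (@deriv k) (cleared g)) * D x by rewrite Dx mulr0.
  rewrite -(derivation_ev _ _ _ dD) -ev_cleared -gE.
  have [_ -> _] := dD; rewrite (derivationX _ _ dD) Dx mulr0 mul0rn mul0r add0r Dy.
  by rewrite evC !(rmorphM, rmorphXn) /= !horner_algX; ring.
move: E; rewrite -rmorphM => /j_inj E.
have u0 : u != 0 by rewrite -size_poly_eq0 su.
have c0 : ('X ^+ (n * size g) * 'X ^+ (n * size g') * u ^+ n)%:P != 0
    :> {poly {poly k}}.
  by rewrite polyC_eq0 !mulf_neq0 // expf_eq0 ?polyX_eq0 ?(negbTE u0) ?andbF.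
have := c0; rewrite -E mulf_eq0 negb_or => /andP[p0 q0].
have := congr1 (fun p : {poly {poly k}} => size p) E.
rewrite size_mul // size_polyC -(polyC_eq0 _) c0 => s1.
have : size (cleared g)^`() = 1%N.
  by move: s1; rewrite (polySpred p0) (polySpred q0) addnS /= addSn => -[/eqP];
  rewrite addn_eq0 => /andP[/eqP-> _].
rewrite size_deriv_pchar0; last exact: pchar_poly0.
rewrite (size_lead_cleared g).1 => sg.
have {}sg : size g = 2 by case: (size g) sg => [|[|[]]].
by exists g; split=> //; rewrite gE nf_small // sg.
Qed.

End Automorphism.

(** * Comparison of coefficients *)

Variables (al be : {lrmorphism B -> B}) (alK : cancel al be) (beK : cancel be al).

Lemma subst_Pxy u q :
  subst u q Pxy = q ^+ m + \sum_(i < m.-1) (f i \Po u)%:P * q ^+ i.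
Proof.
rewrite rmorphD rmorphXn rmorph_sum subst_Y; congr (_ + _).
by apply: eq_bigr => i _; rewrite rmorphM rmorphXn subst_C subst_Y.
Qed.

(** As P has no term in Y^(m-1), the two top coefficients come from q^m alone. *)
Lemma coef_subst_Pxy u q : (size q <= 2)%N ->
  [/\ (size (subst u q Pxy) <= m.+1)%N, (subst u q Pxy)`_m = q`_1 ^+ m
    & (subst u q Pxy)`_m.-1 = (q`_1 ^+ m.-1 * q`_0) *+ m].
Proof.
move=> sq; rewrite subst_Pxy; set T := \sum_(i < _) _.
have mE : m = m.-1.+1 by rewrite prednK // ltnW.
have sT : (size T <= m.-1)%N.
  apply: (leq_trans (size_sum _ _ _)); apply/bigmax_leqP => i _.
  rewrite mul_polyC (leq_trans (size_scale_leq _ _)) //.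
  by rewrite (leq_trans (size_affine_exp _ sq)).
split.
- rewrite (leq_trans (size_polyD _ _)) // geq_max size_affine_exp //.
  by rewrite (leq_trans sT) // (leq_trans (leq_pred _)).
- rewrite coefD [T`__]coef_geq_size ?addr0; last by rewrite (leq_trans sT) ?leq_pred.
  by rewrite {1}(size2_affine sq) (coef_affine_exp _ _ _).1.
- rewrite coefD [T`__]coef_geq_size ?addr0 //.
  by have := (coef_affine_exp q`_1 q`_0 m.-1).2; rewrite -mE -size2_affine.
Qed.

(** The coefficient of y in [be (al y)] = y shows that the leading coefficient of [al y], composed
    with [w], is a unit of k[x]; hence it is a constant. *)
Lemma aut_y : exists (mu : k) (g0 : {poly k}),
  mu != 0 /\ al y = j (mu%:P *: 'X + g0%:P).
Proof.
have [g [ayg sg]] := aut_y_affine alK beK.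
have [h [byh sh]] := aut_y_affine beK alK.
have [w [bw sw]] := aut_x beK alK.
have : be (al y) = y by rewrite alK.
rewrite ayg lrmorph_ev bw byh -ev_subst -[in RHS](evY x y) => /j_inj.
rewrite {1}(size2_affine (eq_leq sg)) rmorphD -mul_polyC rmorphM !subst_C subst_Y.
move/(congr1 (fun p : {poly {poly k}} => p`_1)).
rewrite coefD coefC /= addr0 coefCM coefX /= => E.
have : (g`_1 \Po w) * h`_1 != 0 by rewrite E oner_neq0.
rewrite mulf_eq0 negb_or => /andP[n1 n2].
have := congr1 (fun p : {poly k} => size p) E.
rewrite size_mul // size_poly1 (polySpred n1) (polySpred n2) addSn addnS /= => -[/eqP].
rewrite addn_eq0 => /andP[/eqP s1 _].
have /size_poly1P [mu mu0 Emu] : size g`_1 == 1%N.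
  rewrite -(size_comp_poly2 _ sw) (polySpred n1).
  by rewrite s1.
exists mu, g`_0; split=> //.
by rewrite -Emu -size2_affine // sg.
Qed.

Theorem surface_automorphism :
  exists lambda mu (a : {poly k}) (r : {poly {poly k}}),
    [/\ lambda != 0, mu != 0,
        forall i, (2 <= i <= m)%N ->
          'X^n %| (f (m - i)%N \Po (lambda *: 'X)) - mu ^+ i *: f (m - i)%N &
        [/\ al x = lambda *: x,
            al y = mu *: y + x ^+ n * horner_alg x a,
            (lambda ^+ n *: 'X^n)%:P * r
              = subst (lambda *: 'X) (mu%:P *: 'X + ('X^n * a)%:P) Pxy
                - (mu ^+ m)%:P *: Pxy &
            al z = (mu ^+ m / lambda ^+ n) *: z + j r]].
Proof.
have mE : m = m.-1.+1 by rewrite prednK // ltnW.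
have [u [au su]] := aut_x alK beK; have [mu [g0 [mu0 ay]]] := aut_y.
set q := mu%:P *: 'X + g0%:P in ay.
have sq : (size q <= 2)%N by apply: size_affine.
have q1 : q`_1 = mu%:P by rewrite coefD coefZ coefX coefC /= mulr1 addr0.
have q0 : q`_0 = g0 by rewrite coefD coefZ coefX coefC /= mulr0 add0r.
have [sS Sm Sm1] := coef_subst_Pxy u sq; rewrite q1 q0 in Sm Sm1.
have [h hE] := nf_surj (al z).
have e : horner_alg x (u ^+ n) * nf h = j (subst u q Pxy).
  by rewrite ev_subst -ay -au -lrmorph_ev -xz rmorphM !rmorphXn -hE /= au.
have u0 : u != 0 by rewrite -size_poly_eq0 su.
have sh : (size h <= m.+1)%N.
  by rewrite (size_nf _ e) // expf_eq0 (negbTE u0) andbF.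
(* [nf_base m] is z and the earlier base elements are powers of y, so [al z] is a k[x]-multiple of z
   plus a polynomial [r] in x and y. *)
pose r := take_poly m h.
have rm : r`_m = 0 by rewrite coef_take_poly ltnn.
have hz : nf h = horner_alg x h`_m * z + j r.
  rewrite (nfE sh) big_ord_recr [RHS]addrC; congr (_ + _).
    rewrite -nf_small ?size_take_poly // (nfE (size_take_poly _ _)).
    by apply: eq_bigr => i _; rewrite coef_take_poly ltn_ord.
  by rewrite /nf_base /= divnn (ltnW hm) modnn mulr1 expr1.
have Pm : Pxy`_m = 1 by rewrite coef_Pxy eqxx ltnNge leq_pred addr0.
have Pm1 : Pxy`_m.-1 = 0 by rewrite coef_Pxy ltnn addr0 {2}mE ltn_eqF.
(* The relation is used twice: its image under [al], and again for the z inside [al z]. *)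
have E : ('X^n)%:P * subst u q Pxy
    = (u ^+ n)%:P * ((h`_m)%:P * Pxy + ('X^n)%:P * r).
  apply: j_inj; rewrite rmorphM -e [RHS]rmorphM rmorphD !rmorphM -xz hz !evC.
  have -> : horner_alg x 'X^n = x ^+ n by rewrite rmorphXn /= horner_algX.
  by ring.
have X0 : 'X^n != 0 :> {poly k} by rewrite monic_neq0 ?monicXn.
have Em : 'X^n * (mu ^+ m)%:P = u ^+ n * h`_m.
  have := congr1 (fun p : {poly {poly k}} => p`_m) E.
  by rewrite coefCM Sm coefCM coefD !coefCM Pm rm mulr1 mulr0 addr0 polyC_exp.
pose la := u`_1; pose c := u`_0.
have uE : u = la *: 'X + c%:P by apply: size2_affine; rewrite su.
have la0 : la != 0.
  by have := lead_coef_eq0 u; rewrite /lead_coef su /= => ->.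
(* At the root -c/la of u the right side of [Em] vanishes, so the root is 0. *)
have c0 : c = 0.
  have := congr1 (fun p : {poly k} => p.[- c / la]) Em.
  rewrite !hornerM !horner_exp hornerX hornerC.
  have -> : u.[- c / la] = 0.
    by rewrite uE hornerD hornerZ hornerX hornerC mulrC divfK // addNr.
  move/eqP; rewrite expr0n gtn_eqF ?(ltnW hn) // mul0r mulf_eq0 !expf_eq0 (negbTE mu0).
  rewrite andbF orbF ltnW //= mulf_eq0 invr_eq0 (negbTE la0) orbF oppr_eq0.
  by move/eqP.
have {}uE : u = la *: 'X by rewrite uE c0 addr0.
have un : u ^+ n = (la ^+ n)%:P * 'X^n by rewrite uE exprZn mul_polyC.
have lan : la ^+ n != 0 by rewrite expf_eq0 (negbTE la0) andbF.
have hmE : h`_m = (mu ^+ m / la ^+ n)%:P.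
  apply: (mulfI X0); apply: (mulfI (_ : (la ^+ n)%:P != 0)).
    by rewrite polyC_eq0.
  rewrite mulrA -un -Em [in RHS]mulrCA -polyCM; congr (_ * _%:P).
  by rewrite mulrC divfK.
have {}E : subst u q Pxy = (mu ^+ m)%:P *: Pxy + (la ^+ n *: 'X^n)%:P * r.
  apply: (mulfI (_ : ('X^n)%:P != 0)); first by rewrite polyC_eq0.
  have -> : (mu ^+ m)%:P = (la ^+ n)%:P * h`_m.
    by rewrite hmE -polyCM mulrC divfK.
  rewrite E un -!mul_polyC !(polyCM (la ^+ n)%:P); ring.
(* In degree m - 1, [E] reads b g0 = la^n x^n r_(m-1); [b] is invertible in characteristic zero. *)
pose b := (mu ^+ m.-1) *+ m.
have b0 : b != 0.
  rewrite /b -mulr_natr mulf_neq0 // ?expf_eq0 ?(negbTE mu0) ?andbF //.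
  by move/pcharf0P: hchar => ->; rewrite -lt0n ltnW.
pose a := (la ^+ n / b) *: r`_m.-1.
have g0E : g0 = 'X^n * a.
  apply: (mulfI (_ : b%:P != 0)); first by rewrite polyC_eq0.
  transitivity ((subst u q Pxy)`_m.-1).
    by rewrite Sm1 /b polyCMn polyC_exp mulrnAl.
  rewrite E coefD coefZ Pm1 mulr0 add0r coefCM /a -!mul_polyC.
  have -> : (la ^+ n)%:P = b%:P * (la ^+ n / b)%:P by rewrite -polyCM mulrC divfK.
  by ring.
exists la, mu, a, r; split=> // [i /andP[i2 im]|].
  have qE : q = mu%:P *: 'X + ('X^n)%:P * a%:P by rewrite -polyCM -g0E.
  (* Modulo x^n the shift by x^n a disappears, and the coefficient of Y^(m-i) gives the congruence
     times mu^(m-i). *)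
  have [r' Er'] := comp_poly_shift (map_poly (comp_poly u) Pxy) (mu%:P *: 'X)
    (('X^n)%:P * a%:P).
  have := congr1 (fun p : {poly {poly k}} => p`_(m - i)) E.
  rewrite -[subst u q Pxy]/(map_poly (comp_poly u) Pxy \Po q) qE Er' !coefD.
  rewrite coef_comp_scaleX coef_map /= coefZ -mulrA !coefCM.
  have -> : Pxy`_(m - i) = f (m - i)%N.
    rewrite coef_Pxy ltn_eqF ?add0r ?ltn_subrL ?(ltnW i2) ?(ltnW hm) //.
    by rewrite -subn1 ltn_sub2l.
  rewrite uE -polyC_exp => Ei.
  rewrite -(dvdpZr _ _ (_ : mu ^+ (m - i) != 0)) ?expf_eq0 ?(negbTE mu0) ?andbF //.
  have -> : mu ^+ (m - i) *: ((f (m - i)%N \Po (la *: 'X)) - mu ^+ i *: f (m - i)%N)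
      = 'X^n * ((la ^+ n)%:P * r`_(m - i) - a * r'`_(m - i)).
    rewrite -!mul_polyC in Ei; rewrite scalerBr scalerA -exprD subnK // -!mul_polyC.
    apply: (addIr ('X^n * (a * r'`_(m - i)))); rewrite addrAC.
    rewrite [(mu ^+ (m - i))%:P * _]mulrC Ei; ring.
  by rewrite dvdp_mulr.
split.
- by rewrite au uE linearZ /= horner_algX mulr_algl.
- rewrite ay /q g0E -mul_polyC rmorphD rmorphM evY evA mulr_algl evC.
  by rewrite rmorphM rmorphXn /= horner_algX.
- by rewrite -g0E -uE -/q E addrAC subrr add0r.
- by rewrite hE hz hmE horner_algC mulr_algl.
Qed.


End Surface.
(** * Coordinates on the quotient algebra *)

Section Coordinates.
Variables (k : closedFieldType) (n m : nat) (f : nat -> {poly k}).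
Implicit Types p : {poly {poly k}}.

(** Passage between the two models k[X, Y] and k[X][Y]. *)
Lemma eval2_ev (A : comAlgType k) (u v : A) p :
  eval2 u v (ev X2 Y2 p) = ev u v p.
Proof.
pose h (i : 'I_2) := if i == ord0 then u else v.
apply: (@ev_initial k A (mmap (in_alg A) h \o ev X2 Y2)) => [c||].
- rewrite -[LHS]/(mmap (in_alg A) h (ev X2 Y2 c%:P%:P)) evA.
  by rewrite -mul_mpolyC mulr1 mmapC.
- rewrite -[LHS]/(mmap (in_alg A) h (ev X2 Y2 'X%:P)) evX mmapX mmap1U.
  by rewrite /h ifT //; apply/eqP/val_inj; rewrite /= inordK.
- rewrite -[LHS]/(mmap (in_alg A) h (ev X2 Y2 'X)) evY mmapX mmap1U.
  by rewrite /h ifF //; apply/eqP => /(congr1 val); rewrite /= inordK.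
Qed.

Lemma PpolyE : Ppoly m f = ev X2 Y2 (Pxy m f).
Proof.
rewrite /Ppoly rmorphD rmorphXn evY rmorph_sum; congr (_ + _).
by apply: eq_bigr => i _; rewrite rmorphM rmorphXn evC evY.
Qed.

Lemma BrelE : Brel n m f = X3 ^+ n * Z3 - ev X3 Y3 (Pxy m f).
Proof. by rewrite /Brel PpolyE eval2_ev. Qed.

Local Notation pi := (@Bpi k n m f).

Definition Bpi_rmorphism : {rmorphism {mpoly k[3]} -> Balg n m f} :=
  (\pi_({ideal_quot (Bideal n m f)}))%qT.

Lemma Bpi0 : pi 0 = 0. Proof. exact: (rmorph0 Bpi_rmorphism). Qed.

Lemma Bpi1 : pi 1 = 1. Proof. exact: (rmorph1 Bpi_rmorphism). Qed.

Lemma BpiZ c (p : {mpoly k[3]}) : pi (c *: p) = c *: pi p.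
Proof. by rewrite -mul_mpolyC BpiM. Qed.

Lemma Bpi_ev p : pi (ev X3 Y3 p) = ev (Bx n m f) (By n m f) p.
Proof.
apply: (@ev_initial k _ (Bpi_rmorphism \o ev X3 Y3)) => [c||].
- rewrite -[LHS]/(pi (ev X3 Y3 c%:P%:P)) evA BpiZ; congr (_ *: _).
  exact: Bpi1.
- by rewrite -[LHS]/(pi (ev X3 Y3 'X%:P)) evX.
- by rewrite -[LHS]/(pi (ev X3 Y3 'X)) evY.
Qed.

Lemma Bpi_eq a b : pi a = pi b <-> exists q, a - b = q * Brel n m f.
Proof.
split=> [e|[q e]].
  apply/asboolP; rewrite -[asbool _]/(a - b \in Bideal n m f).
  by rewrite Quotient.idealrBE; apply/eqP.
by apply/eqP; rewrite -Quotient.idealrBE; apply/asboolP; exists q.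
Qed.

(** In k[X][Y][Z] the relation has degree 1 in Z, so it has no nonzero multiple free of Z. *)
Lemma ev_xy_inj : injective (ev (Bx n m f) (By n m f)).
Proof.
suff ev_eq0 p : ev (Bx n m f) (By n m f) p = 0 -> p = 0.
  move=> p q e; apply/eqP; rewrite -subr_eq0; apply/eqP/ev_eq0.
  by rewrite rmorphB e subrr.
rewrite -Bpi_ev -[X in _ = X -> _]Bpi0 => /Bpi_eq [q]; rewrite subr0 BrelE.
pose S := {poly {poly {poly k}}}.
pose C3 : {rmorphism k -> S} := polyC \o (polyC \o polyC).
pose h (i : 'I_3) : S := nth 0 [:: 'X%:P%:P; 'X%:P; 'X] i.
pose th : {rmorphism {mpoly k[3]} -> S} := mmap C3 h.
have thX i : (i < 3)%N -> th 'X_(inord i) = nth 0 [:: 'X%:P%:P; 'X%:P; 'X] i.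
  by move=> i3; rewrite /th /= mmapX mmap1U /h inordK.
have th_ev r : th (ev X3 Y3 r) = r%:P.
  apply: (@poly2_rmorph_ext k S (th \o ev X3 Y3) polyC) => [c||].
  - rewrite -[LHS]/(th (ev X3 Y3 c%:P%:P)) evA -mul_mpolyC mulr1.
    by rewrite /th /= mmapC.
  - by rewrite -[LHS]/(th (ev X3 Y3 'X%:P)) evX thX.
  - by rewrite -[LHS]/(th (ev X3 Y3 'X)) evY thX.
move/(congr1 th); rewrite th_ev rmorphM rmorphB th_ev rmorphM rmorphXn !thX //=.
set T := _ * 'X - _ => E.
have sT : size T = 2.
  have X0 : ('X^n)%:P != 0 :> {poly {poly k}}.
    by rewrite polyC_eq0 expf_eq0 polyX_eq0 andbF.
  rewrite /T -!polyC_exp mul_polyC size_polyDl size_scale ?size_polyX //.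
  by rewrite size_polyN ltnS size_polyC_leq1.
have [q0|q0] := eqVneq (th q) 0.
  by move: E; rewrite q0 mul0r => /eqP; rewrite polyC_eq0 => /eqP.
have T0 : T != 0 by rewrite -size_poly_eq0 sT.
have := size_polyC_leq1 p; rewrite E size_mul // sT (polySpred q0).
by rewrite addn2.
Qed.

Lemma Balg_ind (W : Balg n m f -> Prop) :
  W 1 -> (forall c a b, W a -> W b -> W (c *: a + b)) ->
  (forall b, W b -> [/\ W (Bx n m f * b), W (By n m f * b) & W (Bz n m f * b)]) ->
  forall b, W b.
Proof.
move=> W1 WD WM b.
have W0 : W 0 by have := WD (-1) 1 1 W1 W1; rewrite scaleN1r addNr.
have WX (i : 'I_3) a : W a -> W (pi 'X_i * a).
  move=> /WM [Wx Wy Wz]; rewrite -(inord_val i).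
  by case: i => -[|[|[]]].
have Wmon (M : 'X_{1.. 3}) a : W a -> W (pi 'X_[M] * a).
  pose V (p : {mpoly k[3]}) := forall a, W a -> W (pi p * a).
  rewrite mpolyXE_id; move: a; rewrite -/(V _); apply: (big_ind V).
  - by move=> a Wa; rewrite Bpi1 mul1r.
  - by move=> p q Vp Vq a Wa; rewrite BpiM -mulrA; apply/Vp/Vq.
  move=> i _ a Wa; elim: (M i) => [|e IHe].
    by rewrite [pi _]Bpi1 mul1r.
  by rewrite exprS BpiM -mulrA; apply: WX.
have [p <-] : exists p : {mpoly k[3]}, pi p = b by exists (repr b); apply: reprK.
elim/mpolyind: p => [|c M p _ _ Wp]; first by rewrite Bpi0.
rewrite BpiD BpiZ; apply: WD Wp.
by rewrite -[pi _]mulr1; apply: Wmon.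
Qed.

(** The derivation x^n d/dY + (dP/dY) d/dZ of k[X, Y, Z] kills the relation, hence preserves the
    ideal and descends to the quotient. *)
Lemma Balg_derivation : exists d : Balg n m f -> Balg n m f,
  [/\ derivation d, d (Bx n m f) = 0 & d (By n m f) = Bx n m f ^+ n].
Proof.
pose De (p : {mpoly k[3]}) : {mpoly k[3]} := X3 ^+ n * p^`M(inord 1)
  + ev X3 Y3 (Pxy m f)^`() * p^`M(inord 2).
have dDe : derivation De.
  split=> [a b|a b|c]; rewrite /De.
  - rewrite !mderivD; ring.
  - rewrite !mderivM; ring.
  - by rewrite -mul_mpolyC mulr1 !mderivC !mulr0 addr0.
have mdX i l : (i < 3)%N -> (l < 3)%N ->
    ('X_(inord l) : {mpoly k[3]})^`M(inord i) = (i == l)%:R.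
  move=> i3 l3; rewrite mderivX mnm1E -val_eqE /= !inordK // eq_sym.
  case: eqP => [->|_]; last by rewrite scale0r.
  rewrite scale1r -[RHS]mpolyX0; congr 'X_[_].
  by apply/mnmP => e; rewrite mnmBE subnn mnm0E.
have DX : De X3 = 0 by rewrite /De !mdX // !mulr0 addr0.
have DY : De Y3 = X3 ^+ n by rewrite /De !mdX // mulr1 mulr0 addr0.
have DZ : De Z3 = ev X3 Y3 (Pxy m f)^`() by rewrite /De !mdX // mulr0 mulr1 add0r.
have [DD DM DA] := dDe.
have DN a : De (- a) = - De a by rewrite /De !mderivN; ring.
have DB : De (Brel n m f) = 0.
  rewrite BrelE DD DN DM (derivationX _ _ dDe) DX mulr0 mul0rn mul0r add0r DZ.
  by rewrite (derivation_ev _ _ _ dDe) DX DY mulr0 add0r mulrC subrr.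
have piDe a b : pi a = pi b -> pi (De a) = pi (De b).
  move=> /Bpi_eq [q e]; apply/Bpi_eq; exists (De q).
  by rewrite -DN -DD e DM DB mulr0 addr0.
have reprE b : pi (repr b) = b by apply: reprK.
have piE (p : {mpoly k[3]}) : pi (De (repr (pi p))) = pi (De p) by apply: piDe.
exists (fun b => pi (De (repr b))); split.
- split=> [a b|a b|c].
  + rewrite -BpiD -DD; apply: piDe.
    by rewrite BpiD !reprE.
  + rewrite -[X in _ * X + _]reprE -[X in _ + X * _]reprE -!BpiM -BpiD -DM.
    by apply: piDe; rewrite BpiM !reprE.
  + rewrite -Bpi1 -BpiZ piE DA.
    exact: Bpi0.
- by rewrite piE DX; exact: Bpi0.
- by rewrite piE DY; exact: (rmorphXn Bpi_rmorphism).
Qed.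

End Coordinates.

(** * Transfer to the quotient algebra *)

Theorem proposition6p4 (k : closedFieldType) (hchar : [pchar k] =i pred0)
    (n m : nat) (hn : (2 <= n)%N) (hm : (2 <= m)%N) (f : nat -> {poly k})
    (alpha : {lrmorphism Balg n m f -> Balg n m f})
    (halpha : bijective alpha) :
  exists (lambda mu : k) (a : {poly k}),
    [/\ lambda != 0,
        mu != 0,
        forall i : nat, (2 <= i <= m)%N ->
          'X^n %| (f (m - i)%N \Po (lambda *: 'X)) - mu ^+ i *: f (m - i)%N &
        [/\ alpha (Bx n m f) = lambda *: Bx n m f,
            alpha (By n m f)
              = mu *: By n m f + Bx n m f ^+ n * horner_alg (Bx n m f) a &
            (* Q is the fraction (P(lambda X, mu Y + X^n a(X)) - mu^m P(X, Y))
               / (lambda^n X^n), an element of k[X, Y]. *)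
            exists Q : {mpoly k[2]},
              (lambda ^+ n *: X2 ^+ n) * Q
                = eval2 (lambda *: X2) (mu *: Y2 + X2 ^+ n * horner_alg X2 a)
                        (Ppoly m f)
                  - mu ^+ m *: Ppoly m f
              /\ alpha (Bz n m f)
                = (mu ^+ m / lambda ^+ n) *: Bz n m f
                  + eval2 (Bx n m f) (By n m f) Q]].
Proof.
have [be alK beK] := halpha.
pose beL : {lrmorphism Balg n m f -> Balg n m f} :=
  HB.pack be (GRing.isLinear.Build k (Balg n m f) (Balg n m f) *:%R be
                (can2_linear alK beK))
             (GRing.isMonoidMorphism.Build (Balg n m f) (Balg n m f) be
                (can2_monoid_morphism alK beK)).
have xz : Bx n m f ^+ n * Bz n m f = ev (Bx n m f) (By n m f) (Pxy m f).
  by rewrite B_relation PpolyE eval2_ev.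
have [d [dd dx dy]] := Balg_derivation n m f.
have [la [mu [a [r [la0 mu0 fcong [ax ay rE az]]]]]] :=
  @surface_automorphism k n m f hchar hn hm _ _ _ _ (@ev_xy_inj k n m f) xz
    (@Balg_ind k n m f) d dd dx dy alpha beL alK beK.
exists la, mu, a; split=> //; split=> //.
exists (ev X2 Y2 r); split; last by rewrite eval2_ev.
rewrite PpolyE eval2_ev.
have evZ c (p : {poly {poly k}}) : ev X2 Y2 (c%:P *: p) = c *: ev X2 Y2 p.
  by rewrite -mul_polyC rmorphM evA mulr_algl.
have -> : la *: X2 = horner_alg X2 (la *: 'X).
  by rewrite linearZ /= horner_algX mulr_algl.
have -> : mu *: Y2 + X2 ^+ n * horner_alg X2 a
    = ev X2 Y2 (mu%:P *: 'X + ('X^n * a)%:P).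
  by rewrite rmorphD evZ evY evC rmorphM rmorphXn /= horner_algX.
rewrite -ev_subst -evZ -rmorphB -rE rmorphM evC linearZ rmorphXn /=.
by rewrite horner_algX mulr_algl.
Qed.
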